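(* Let $n\ge2$, let $J$ be a cube in $\mathbb{R}^n$, let $0\le\alpha<n$, let $\gamma>2$, and let $C_0>0$ be given. For $\gamma$ sufficiently large, there exists a positive measure $\mu$ on $\mathbb{R}^n$, supported outside $\gamma J$ and depending only on $n$, $\alpha$ and $\gamma$ (for the given cube $J$), such that the strong reversal of energy inequality $$\mathsf{E}(J,\omega)^2\,\mathrm{P}^\alpha(J,\mu)^2\le C_0\ \mathbb{E}_J^{d\omega(x)}\mathbb{E}_J^{d\omega(z)}\left|\mathbf{T}^\alpha\mu(x)-\mathbf{T}^\alpha\mu(z)\right|^2$$ fails (i.e. there is a locally finite positive Borel measure $\omega$ with $|J|_\omega>0$ for which it is false) for any vector $\mathbf{T}^\alpha=\{T^\alpha_\ell\}_{\ell=1}^N$ of $\alpha$-fractional smooth Calderón--Zygmund operators in $\mathbb{R}^n$ with convolution kernels $K^\alpha_\ell(w)=\frac{\Omega_\ell(w/|w|)}{|w|^{n-\alpha}}$, where each $\Omega_\ell$ is smooth on $\mathbb{S}^{n-1}$ and has vanishing integral on every great circle in the sphere $\mathbb{S}^{n-1}$. In particular, this holds if each $K^\alpha_\ell$ is odd.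
   Context: For a cube $J\subset\mathbb{R}^n$, $|J|$ is its Lebesgue measure, $c_J$ its center, $\gamma J$ the concentric cube with side length $\gamma$ times that of $J$, and $|J|_\omega=\omega(J)$. The average is $\mathbb{E}_J^{d\omega(x)}f(x)=\frac1{|J|_\omega}\int_J f(x)\,d\omega(x)$. Energy: $\mathsf{E}(J,\omega)^2=\frac{1}{|J|_\omega}\frac1{|J|_\omega}\int_J\int_J\left|\frac{x-z}{|J|^{1/n}}\right|^2d\omega(x)\,d\omega(z)$. Fractional Poisson integral: $\mathrm{P}^\alpha(J,\mu)=\int_{\mathbb{R}^n}\frac{|J|^{1/n}}{\left(|J|^{1/n}+|y-c_J|\right)^{n+1-\alpha}}\,d\mu(y)$. For an operator $T$ with convolution kernel $K$ and $\mu$ supported outside $\gamma J$, $T\mu(x)=\int K(x-y)\,d\mu(y)$ for $x\in J$. For a vector $\mathbf{T}^\alpha=\{T_\ell^\alpha\}_{\ell=1}^N$ of such operators, $\mathbf{T}^\alpha\mu=(T_\ell^\alpha\mu)_{\ell=1}^N$ and $|\cdot|$ is the Euclidean norm. A great circle of $\mathbb{S}^{n-1}$ is its intersection with a two-dimensional linear subspace of $\mathbb{R}^n$ (for $n=2$, the whole circle); integrals over it are with respect to arc length. *)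

(* Defs.v *)
From HB Require Import structures.
From mathcomp Require Import all_boot all_order all_algebra.
From mathcomp Require Import all_classical all_reals all_analysis.

Set Implicit Arguments.
Unset Strict Implicit.
Unset Printing Implicit Defensive.

Import Order.TTheory GRing.Theory Num.Theory.
Import numFieldNormedType.Exports.

Local Open Scope classical_set_scope.
Local Open Scope ring_scope.

Section Geometry.
Context {R : realType} {n : nat}.
Implicit Types (x u v : 'rV[R]_n).

Definition dotr u v : R := \sum_(i < n) u 0 i * v 0 i.

(* The library norm of ['rV[R]_n] is the sup norm; it induces the same topology,
   but the quantities below involve the Euclidean norm. *)
Definition enorm x : R := Num.sqrt (dotr x x).

Definition usphere : set 'rV[R]_n := [set x | enorm x = 1].

Definition box (c : 'rV[R]_n) (s : R) : set 'rV[R]_n :=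
  [set x | forall i, `|x 0 i - c 0 i| <= s / 2].

End Geometry.

(* Cubes are closed, with sides parallel to the coordinate axes. *)
Record cube (R : realType) (n : nat) := Cube {
  center : 'rV[R]_n;
  side : R;
  side_gt0 : 0 < side }.

Section Cubes.
Context {R : realType} {n : nat}.
Implicit Type J : cube R n.

Definition cube_set J : set 'rV[R]_n := box (center J) (side J).

Definition dilate (g : R) J : set 'rV[R]_n := box (center J) (g * side J).

(* The Lebesgue measure |J|, as the product of the lengths of the n sides, and
   |J|^(1/n). *)
Definition cube_volume J : R := side J ^+ n.

Definition cube_length J : R := cube_volume J `^ (n%:R^-1).

End Cubes.

(* R^n with its Borel sigma-algebra. *)
Notation borelRn R n := (g_sigma_algebraType (@open 'rV[R]_n)).

Section Measures.
Context {R : realType} {n : nat}.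
Implicit Type mu : {measure set (borelRn R n) -> \bar R}.

Definition locally_finite mu :=
  forall x : 'rV[R]_n, exists U, open_nbhs x U /\ (mu U < +oo)%E.

Definition measure_support mu : set 'rV[R]_n :=
  [set x | forall U, open_nbhs x U -> (0 < mu U)%E].

(* Meaningful for 0 < omega A < +oo. *)
Definition average (omega : {measure set (borelRn R n) -> \bar R})
    (A : set 'rV[R]_n) (f : 'rV[R]_n -> \bar R) : \bar R :=
  ((\int[omega]_(x in A) f x) / omega A)%E.

Definition energy_sq (J : cube R n) omega : \bar R :=
  average omega (cube_set J) (fun x =>
    average omega (cube_set J) (fun z =>
      (enorm ((cube_length J)^-1 *: (x - z)) ^+ 2)%:E)).

Definition poisson (alpha : R) (J : cube R n) mu : \bar R :=
  (\int[mu]_y (cube_length J /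
     (cube_length J + enorm ((y : 'rV[R]_n) - center J))
       `^ (n%:R + 1 - alpha))%:E)%E.

End Measures.

Section Smoothness.
Context {R : realType} {n : nat}.

(* C^infinity on the open set U: every iterated directional derivative exists
   and is Frechet differentiable at every point of U. *)
Definition smooth_on (U : set 'rV[R]_n) (f : 'rV[R]_n -> R) :=
  forall (vs : seq 'rV[R]_n) (x : 'rV[R]_n), U x ->
    differentiable (foldr (fun v (g : 'rV[R]_n -> R) => 'D_v g) f vs) x.

(* Smooth on the unit sphere as an embedded submanifold: the restriction of a
   smooth function on an open neighbourhood. Only the values of Omega on the
   sphere matter. *)
Definition smooth_on_sphere (Omega : 'rV[R]_n -> R) :=
  exists (U : set 'rV[R]_n) (g : 'rV[R]_n -> R),
    [/\ open U, usphere `<=` U, smooth_on U g &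
        forall x, usphere x -> Omega x = g x].

(* A great circle is the intersection of the sphere with the plane spanned by
   an orthonormal pair (u, v), and t |-> cos t u + sin t v is its arc-length
   parametrization. *)
Definition vanishing_on_great_circles (Omega : 'rV[R]_n -> R) :=
  forall u v : 'rV[R]_n, enorm u = 1 -> enorm v = 1 -> dotr u v = 0 ->
    \int[@lebesgue_measure R]_(t in `[0, 2 * pi])
      Omega (cos t *: u + sin t *: v) = 0.

Definition homogeneous_kernel (alpha : R) (Omega : 'rV[R]_n -> R)
    (w : 'rV[R]_n) : R :=
  Omega ((enorm w)^-1 *: w) / enorm w `^ (n%:R - alpha).

Definition odd_kernel (K : 'rV[R]_n -> R) :=
  forall w, w != 0 -> K (- w) = - K w.

End Smoothness.

Section Reversal.
Context {R : realType} {n : nat}.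
Variables (alpha : R) (J : cube R n) (N : nat).
Variable K : 'I_N -> 'rV[R]_n -> R.
Variable mu : {measure set (borelRn R n) -> \bar R}.

(* Absolute convergence, on J, of the integrals defining T mu; without it the
   value of [conv_op] would be a convention. *)
Definition conv_op_defined :=
  forall (l : 'I_N) (x : 'rV[R]_n), cube_set J x ->
    mu.-integrable setT (fun y => (K l (x - (y : 'rV[R]_n)))%:E).

Definition conv_op (x : 'rV[R]_n) : 'rV[R]_N :=
  \row_(l < N) \int[mu]_y K l (x - (y : 'rV[R]_n)).

Definition strong_energy_reversal (C0 : R)
    (omega : {measure set (borelRn R n) -> \bar R}) :=
  (energy_sq J omega * poisson alpha J mu ^+ 2 <=
   C0%:E * average omega (cube_set J) (fun x =>
     average omega (cube_set J) (fun z =>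
       (enorm (conv_op x - conv_op z) ^+ 2)%:E)))%E.

Definition strong_energy_reversal_fails (C0 : R) :=
  conv_op_defined /\
  exists omega : {measure set (borelRn R n) -> \bar R},
    [/\ locally_finite omega, (0 < omega (cube_set J))%E &
        ~ strong_energy_reversal C0 omega].

End Reversal.

(* Main.v *)
Require Import Defs.
From HB Require Import structures.
From mathcomp Require Import all_boot all_order all_algebra.
From mathcomp Require Import all_classical all_reals all_analysis.
From mathcomp Require Import measurable_realfun.
From mathcomp Require Import ring lra.
Import Order.TTheory GRing.Theory Num.Theory.
Import numFieldNormedType.Exports.
Local Open Scope classical_set_scope.
Local Open Scope ring_scope.

(** The measure [mu] is built so that, for every kernel [K] homogeneous of
degree [alpha - n], the potential [y |-> \int K (y - t) dmu(t)] takes the same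
value at two distinct points [x] and [z] of [J].  Taking for [omega] the sum of
the Dirac masses at [x] and [z], the right-hand side of the reversal inequality
is then zero, whereas the energy of [J] is positive because [x <> z] and the
Poisson integral is positive because [mu] is nonzero.

To obtain the equality of the potentials, fix [0 < rho < 1] and let [S] be the
homothety of ratio [rho] that maps [z] to [x], so that
[x - S y = rho (z - y)] and therefore
[rho ^ (n - alpha) K (x - S y) = K (z - y)].  Give the points
[a_k = S^k a_0] of an orbit the masses [rho ^ ((n - alpha) k)]: the contribution
of [a_(k+1)] to the potential at [x] is the contribution of [a_k] to the
potential at [z], so the two potentials of the orbit differ by the single term
[K (x - a_0)].  The homothety [S'] of ratio [rho] that maps [x] to [z] gives in
the same way an orbit [b_k] whose potentials differ by [- K (z - b_0)].  When
[x - a_0 = z - b_0] the two defects cancel (lemmas [chainS],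
[eq_integral_paired_atoms] and [potential_chain_measure]).

Since [alpha < n] the masses decrease geometrically, hence [mu] is finite.  An
orbit lies on the segment from its first point to the fixed point of the
homothety.  With [x] the centre of [J] and [z] on a face of [J], this fixed
point is at a distance from [J] comparable to the side of [J] divided by
[1 - rho].  The first points [a_0] and [b_0] are put equally far away, in a
direction orthogonal to [z - x], so that [rho] close to [1] pushes both segments
out of [gamma J] (lemmas [left_chain_far] and [right_chain_far]).

The kernels are continuous off the origin ([continuous_homogeneous_kernel]),
hence Borel, and bounded on the closed annulus that contains the orbits, which
gives the absolute convergence of the integrals. *)

(** * Measures carried by two sequences of weighted atoms *)

Section PairedAtoms.
Context {d} {T : measurableType d} {R : realType}.
Variables (m : {nonneg R}^nat) (a b : T^nat).
Local Open Scope ereal_scope.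

Definition paired_atoms : {measure set T -> \bar R} :=
  mseries (fun k => mscale (m k) (measure_add \d_(a k) \d_(b k))) 0%N.

Lemma ge0_integral_paired_atoms (f : T -> \bar R) :
  measurable_fun setT f -> (forall t, 0 <= f t) ->
  \int[paired_atoms]_t f t =
  \sum_(k <oo) ((m k)%:num%:E * f (a k) + (m k)%:num%:E * f (b k)).
Proof.
move=> mf f0.
rewrite /paired_atoms ge0_integral_measure_series//.
apply: eq_eseriesr => k _.
rewrite ge0_integral_mscale// ge0_integral_measure_add//.
by rewrite !integral_dirac// !diracT !mul1e ge0_muleDr.
Qed.

Lemma paired_atomsE (A : set T) :
  paired_atoms A = \sum_(k <oo) ((m k)%:num%:E * (\d_(a k) A + \d_(b k) A)).
Proof.
rewrite /paired_atoms /= /mseries.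
by apply: eq_eseriesr => k _; rewrite -measure_addE.
Qed.

Lemma nneseries_shift (u v : (\bar R)^nat) :
  (forall k, 0 <= u k) -> (forall k, u k.+1 = v k) ->
  \sum_(k <oo) u k = u 0%N + \sum_(k <oo) v k.
Proof.
move=> u0 uv.
rewrite nneseries_recl//; congr (_ + _).
by rewrite -[LHS]nneseries_addn//; apply: eq_eseriesr => k _; rewrite addn1 uv.
Qed.

Lemma ge0_eq_integral_paired_atoms (f g : T -> \bar R) :
  measurable_fun setT f -> measurable_fun setT g ->
  (forall t, 0 <= f t) -> (forall t, 0 <= g t) ->
  f (a 0%N) = g (b 0%N) ->
  (forall k, (m k.+1)%:num%:E * f (a k.+1) = (m k)%:num%:E * g (a k)) ->
  (forall k, (m k.+1)%:num%:E * g (b k.+1) = (m k)%:num%:E * f (b k)) ->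
  \int[paired_atoms]_t f t = \int[paired_atoms]_t g t.
Proof.
move=> mf mg f0 g0 fg0 fgS gfS.
have mf0 k t : 0 <= (m k)%:num%:E * f t by rewrite mule_ge0.
have mg0 k t : 0 <= (m k)%:num%:E * g t by rewrite mule_ge0.
rewrite !ge0_integral_paired_atoms//.
rewrite !nneseriesD//.
rewrite (@nneseries_shift (fun k => (m k)%:num%:E * f (a k)) _ _ fgS)//.
rewrite (@nneseries_shift (fun k => (m k)%:num%:E * g (b k)) _ _ gfS)//.
by rewrite fg0 -addeA addeCA.
Qed.

(** The hypotheses say that the series of the values of [f] and [g] on the atoms
are rearrangements of one another: the [a]-part of [f] is that of [g] shifted by
one step, and conversely for the [b]-part, the two extra terms being equal.  For
nonnegative functions this suffices; in general it is applied to the positive and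
the negative parts separately, which avoids rearranging a signed series. *)
Lemma eq_integral_paired_atoms (f g : T -> R) :
  measurable_fun setT f -> measurable_fun setT g ->
  f (a 0%N) = g (b 0%N) ->
  (forall k, (m k.+1)%:num * f (a k.+1) = (m k)%:num * g (a k))%R ->
  (forall k, (m k.+1)%:num * g (b k.+1) = (m k)%:num * f (b k))%R ->
  \int[paired_atoms]_t (f t)%:E = \int[paired_atoms]_t (g t)%:E.
Proof.
move=> mf mg fg0 fgS gfS.
(* [p] stands for the positive part and for the negative part. *)
have part (p : R -> R) : (measurable_fun setT p) -> (forall x, 0 <= p x)%R ->
    (forall c x, 0 <= c -> p (c * x) = c * p x)%R ->
    \int[paired_atoms]_t (p (f t))%:E = \int[paired_atoms]_t (p (g t))%:E.
  move=> mp p0 ph; apply: ge0_eq_integral_paired_atoms.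
  - by apply/measurable_EFinP; exact: measurableT_comp.
  - by apply/measurable_EFinP; exact: measurableT_comp.
  - by move=> t; rewrite lee_fin.
  - by move=> t; rewrite lee_fin.
  - by rewrite fg0.
  - by move=> k; rewrite -!EFinM -!ph// fgS.
  - by move=> k; rewrite -!EFinM -!ph// gfS.
rewrite integralE [RHS]integralE.
under eq_integral do rewrite funeposE -EFin_max.
under [X in _ - X]eq_integral do rewrite funenegE -EFinN -EFin_max.
under [X in _ = X - _]eq_integral do rewrite funeposE -EFin_max.
under [X in _ = _ - X]eq_integral do rewrite funenegE -EFinN -EFin_max.
congr (_ - _).
  apply: (part (fun x => Num.max x 0)%R).
  - by apply: measurable_maxr; [exact: measurable_id|exact: measurable_cst].
  - by move=> x; rewrite le_max lexx orbT.
  - by move=> c x c0; rewrite maxr_pMr// mulr0.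
apply: (part (fun x => Num.max (- x) 0)%R).
- by apply: measurable_maxr; [exact: oppr_measurable|exact: measurable_cst].
- by move=> x; rewrite le_max lexx orbT.
- by move=> c x c0; rewrite maxr_pMr// mulr0 mulrN.
Qed.

Lemma integrable_paired_atoms (f : T -> R) (M : R) :
  measurable_fun setT f -> paired_atoms setT < +oo ->
  (forall k, `|f (a k)| <= M)%R -> (forall k, `|f (b k)| <= M)%R ->
  paired_atoms.-integrable setT (EFin \o f).
Proof.
move=> mf mu_fin fa fb.
have M0 : (0 <= M)%R by exact: le_trans (fa 0%N).
apply/integrableP; split; first exact/measurable_EFinP.
rewrite ge0_integral_paired_atoms//; last first.
  by apply/measurable_EFinP; apply: measurableT_comp.
apply: (@le_lt_trans _ _ (\int[paired_atoms]_t M%:E)).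
  rewrite ge0_integral_paired_atoms//.
  apply: lee_nneseries => k _ /=.
    by rewrite adde_ge0// mule_ge0.
  by rewrite leeD// lee_wpmul2l// lee_fin.
by rewrite integral_cst//= lte_mul_pinfty.
Qed.

Lemma paired_atoms_integral_gt0 (f : T -> \bar R) :
  measurable_fun setT f -> (forall t, 0 < f t) -> (0 < (m 0%N)%:num)%R ->
  0 < \int[paired_atoms]_t f t.
Proof.
move=> mf f0 m0; have f0' t : 0 <= f t by exact/ltW.
rewrite ge0_integral_paired_atoms//.
have u0 k : 0 <= (m k)%:num%:E * f (a k) + (m k)%:num%:E * f (b k).
  by rewrite adde_ge0// mule_ge0.
rewrite (nneseries_shift _ _ u0 (fun=> erefl)).
apply: (@lt_le_trans _ _ ((m 0%N)%:num%:E * f (a 0%N) +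
    (m 0%N)%:num%:E * f (b 0%N))).
  by rewrite adde_gt0// mule_gt0.
by rewrite leeDl//; apply: nneseries_ge0 => k _ _; exact: u0.
Qed.

Lemma paired_atoms_geometric_finite (q : R) :
  (0 < q < 1)%R -> (forall k, (m k)%:num = q ^+ k)%R ->
  paired_atoms setT < +oo.
Proof.
move=> /andP[q0 q1] mq.
rewrite paired_atomsE.
have -> : \sum_(k <oo) ((m k)%:num%:E * (\d_(a k) setT + \d_(b k) setT)) =
    limn (EFin \o series (geometric 2%R q)).
  congr (lim (_ @ \oo)); apply/funext => k /=.
  rewrite /series/= -sumEFin; apply: eq_bigr => i _.
  by rewrite !diracT -EFinD -EFinM mq mulrC.
rewrite EFin_lim ?ltry//; apply: is_cvg_geometric_series.
by rewrite gtr0_norm.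
Qed.

Lemma paired_atoms_eq0 (A : set T) :
  (forall k, ~ A (a k)) -> (forall k, ~ A (b k)) -> paired_atoms A = 0.
Proof.
move=> Aa Ab; rewrite paired_atomsE eseries0// => k _ _.
by rewrite !diracE !memNset// adde0 mule0.
Qed.

End PairedAtoms.

(** * Averages with respect to two Dirac masses *)

Section DiracPair.
Context {d} {T : measurableType d} {R : realType}.
Variables (a b : T).
Hypotheses (ab : a <> b) (ma : measurable [set a]) (mb : measurable [set b]).
Local Open Scope ereal_scope.
Import HBNNSimple.

Definition dirac_pair : {measure set T -> \bar R} :=
  measure_add \d_a \d_b.

Lemma dirac_pair_mass (D : set T) : D a -> D b -> dirac_pair D = 2%:E.
Proof.
move=> Da Db; rewrite (_ : dirac_pair D = \d_a D + \d_b D).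
  by rewrite !diracE !mem_set.
exact: measure_addE.
Qed.

Lemma ge0_integral_dirac_pair (f : T -> \bar R) :
  measurable_fun setT f -> (forall t, 0 <= f t) ->
  \int[dirac_pair]_t f t = f a + f b.
Proof.
move=> mf f0; rewrite ge0_integral_measure_add//.
by rewrite !integral_dirac// !diracT !mul1e.
Qed.

(** The integral of a nonnegative function is the supremum of the integrals of
the simple functions below it.  Each of these is at most [f a + f b], and the
function equal to [f] on [{a, b}] and to [0] elsewhere is measurable, lies below
[f], and has integral [f a + f b].  Hence the oscillation of a potential can be
averaged without studying its dependence on the point. *)
Lemma integral_dirac_pair (D : set T) (f : T -> \bar R) :
  D a -> D b -> (forall t, 0 <= f t) ->
  \int[dirac_pair]_(t in D) f t = f a + f b.
Proof.
move=> Da Db f0.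
have /eqP abF := ab.
have fD0 t : 0 <= (f \_ D) t by rewrite /patch; case: ifP.
have -> : \int[dirac_pair]_(t in D) f t = \int[dirac_pair]_t (f \_ D) t.
  by rewrite integral_mkcond.
have [fDa fDb] : (f \_ D) a = f a /\ (f \_ D) b = f b.
  by rewrite /patch !mem_set.
rewrite -fDa -fDb; move: (f \_ D) fD0 => {f0 fDa fDb} {}f f0.
apply/eqP; rewrite eq_le; apply/andP; split.
  rewrite ge0_integralTE//; apply: ge_ereal_sup => _ [h hf <-].
  rewrite -integralT_nnsfun.
  rewrite ge0_integral_dirac_pair ?leeD//.
    by apply/measurable_EFinP.
  by move=> t; rewrite lee_fin.
pose g t := f a * (\1_[set a] t)%:E + f b * (\1_[set b] t)%:E.
have g0 t : 0 <= g t by rewrite adde_ge0// mule_ge0// lee_fin.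
have -> : f a + f b = \int[dirac_pair]_t g t.
  rewrite ge0_integral_dirac_pair//.
    rewrite /g !indicE !classical_sets.in_set1 !eqxx (eq_sym b) (negbTE abF).
    by rewrite !mule1 !mule0 adde0 add0e.
  apply: emeasurable_funD; apply: measurable_funeM;
    by apply/measurable_EFinP; exact: measurable_indic.
have gf t : g t <= f t.
  rewrite /g !indicE !classical_sets.in_set1.
  have [->|ta] := eqVneq t a.
    by rewrite (negbTE abF) mule1 mule0 adde0.
  by have [->|tb] := eqVneq t b; rewrite ?mule1 ?mule0 ?add0e.
rewrite !ge0_integralTE//; apply: ereal_sup_le => _ [h hg <-].
by exists h => // t; exact: le_trans (gf t).
Qed.

End DiracPair.

(** * Euclidean norm and homogeneous kernels *)

Section EuclideanNorm.
Context {R : realType} {n : nat}.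
Implicit Types (w x : 'rV[R]_n) (t : R).

Lemma dotr_ge0 w : 0 <= dotr w w.
Proof. by apply: sumr_ge0 => i _; rewrite -expr2 sqr_ge0. Qed.

Lemma enorm_gt0 w : (0 < enorm w) = (w != 0).
Proof.
rewrite /enorm sqrtr_gt0 lt0r dotr_ge0 andbT; congr negb.
rewrite psumr_eq0; last by move=> i _; rewrite -expr2 sqr_ge0.
apply/allP/eqP => [w0|-> i _]; last by rewrite /= !mxE mulr0 eqxx.
apply/rowP => i; rewrite mxE; apply/eqP.
by have := w0 i (mem_index_enum i); rewrite /= mulf_eq0 orbb.
Qed.

Lemma enormZ t w : 0 <= t -> enorm (t *: w) = t * enorm w.
Proof.
move=> t0; rewrite /enorm.
have -> : dotr (t *: w) (t *: w) = t ^+ 2 * dotr w w.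
  by rewrite /dotr mulr_sumr; apply: eq_bigr => i _; rewrite !mxE mulrACA.
by rewrite sqrtrM ?sqr_ge0// sqrtr_sqr ger0_norm.
Qed.

Lemma enorm0 : enorm (0 : 'rV[R]_n) = 0.
Proof. by rewrite -[X in enorm X](scale0r 0) enormZ// mul0r. Qed.

Lemma continuous_enorm : continuous (@enorm R n).
Proof.
move=> x; apply: continuous_comp; last exact: sqrt_continuous.
apply: continuous_big => [|i _ {}x]; first exact: add_continuous.
have ci : {for x, continuous (fun w : 'rV[R]_n => w 0 i)}.
  exact: coord_continuous.
exact: (continuousM ci ci).
Qed.

Lemma open_rV_neq x : open [set y | y != x].
Proof.
rewrite (_ : [set y | _] = ~` [set x]); last first.
  by apply/seteqP; split => y /eqP.
apply: closed_openC; apply: accessible_closed_set1.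
exact/hausdorff_accessible/norm_hausdorff.
Qed.

Lemma coord_le_norm w i : `|w 0 i| <= `|w|.
Proof.
by rewrite [leRHS]/Num.norm /= mx_normrE; exact: (le_bigmax _ _ (0, i)).
Qed.

Lemma norm_le_coord w t : 0 <= t -> (forall i, `|w 0 i| <= t) -> `|w| <= t.
Proof.
move=> t0 wt; rewrite [leLHS]/Num.norm /= mx_normrE.
by apply: bigmax_le => // -[j i] _ /=; rewrite ord1.
Qed.

End EuclideanNorm.

Lemma continuous_powR_gt0 (R : realType) (p x : R) :
  0 < x -> {for x, continuous (fun y : R => y `^ p)}.
Proof.
move=> x0; apply/differentiable_continuous/derivable1_diffP.
by apply: derivable_powR; rewrite in_itv/= x0.
Qed.

Section Kernel.
Context {R : realType} {n : nat}.
Variables (alpha : R) (Omega : 'rV[R]_n -> R).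
Implicit Types (w x : 'rV[R]_n).
Let K := homogeneous_kernel alpha Omega.

(** The factor is the ratio of the masses of consecutive points of an orbit: the
masses decrease as fast as the kernel grows under the homothety. *)
Lemma homogeneous_kernelZ t w : 0 < t ->
  t `^ (n%:R - alpha) * K (t *: w) = K w.
Proof.
move=> t0; rewrite /K /homogeneous_kernel enormZ ?ltW// powRM ?sqrtr_ge0 ?ltW//.
rewrite scalerA invfM mulrAC mulVf ?gt_eqF// mul1r.
by rewrite invfM mulrCA mulVKf// gt_eqF// powR_gt0.
Qed.

(** Off the origin, normalization reaches the sphere, where [Omega] agrees with a
function that is smooth on an open set. *)
Lemma continuous_homogeneous_kernel w :
  smooth_on_sphere Omega -> w != 0 -> {for w, continuous K}.
Proof.
move=> [U [g [Uo SU sg Og]]] w0.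
have unit (v : 'rV[R]_n) : v != 0 -> usphere ((enorm v)^-1 *: v).
  move=> v0; rewrite /usphere /= enormZ ?invr_ge0 ?sqrtr_ge0// mulVf//.
  by rewrite gt_eqF// enorm_gt0.
have ew : enorm w != 0 by rewrite gt_eqF// enorm_gt0.
have nzw : \forall v \near w, v != 0.
  by apply: open_nbhs_nbhs; split => //; exact: open_rV_neq.
rewrite /prop_for /continuous_at /K.
rewrite [X in _ --> X]/homogeneous_kernel (Og _ (unit _ w0)).
pose h (v : 'rV[R]_n) := g ((enorm v)^-1 *: v) / enorm v `^ (n%:R - alpha).
have hK : \forall v \near w, h v = homogeneous_kernel alpha Omega v.
  near=> v; rewrite /homogeneous_kernel Og//; apply: unit.
  by near: v.
apply: (cvg_trans (near_eq_cvg hK)).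
apply: cvgM.
  apply: (@cvg_comp _ _ _ (fun v => (enorm v)^-1 *: v) g).
    apply: cvgZ; last exact: cvg_id.
    exact: (cvgV ew (continuous_enorm w)).
  exact: (differentiable_continuous (sg [::] _ (SU _ (unit _ w0)))).
apply: cvgV; first by rewrite gt_eqF// powR_gt0// enorm_gt0.
apply: (@cvg_comp _ _ _ (@enorm R n) (fun y => y `^ (n%:R - alpha))).
  exact: continuous_enorm.
by apply: continuous_powR_gt0; rewrite enorm_gt0.
Unshelve. all: by end_near. Qed.

Lemma continuous_translated_kernel x y : smooth_on_sphere Omega -> y != x ->
  {for y, continuous (fun t : 'rV[R]_n => K (x - t))}.
Proof.
move=> smO yx; apply: (@continuous_comp _ _ _ (fun t : 'rV[R]_n => x - t) K).
  by apply: continuousB; [exact: cst_continuous|exact: cvg_id].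
by apply: continuous_homogeneous_kernel => //; rewrite subr_eq0 eq_sym.
Qed.

End Kernel.

(** * Functions that are continuous off one point *)

Section ContinuousOffPoint.
Context {R : realType} {n : nat}.

Lemma borel_open (U : set 'rV[R]_n) :
  open U -> measurable (U : set (borelRn R n)).
Proof. by move=> Uo; exact: sub_sigma_algebra. Qed.

Lemma borel_set1 (x : 'rV[R]_n) : measurable ([set x] : set (borelRn R n)).
Proof.
rewrite -(setCK [set x]); apply: measurableC; apply: borel_open.
rewrite (_ : ~` [set x] = [set y | y != x]); first exact: open_rV_neq.
by apply/seteqP; split => y /eqP.
Qed.

Variables (f : 'rV[R]_n -> R) (p : 'rV[R]_n).
Hypothesis fc : forall y, y != p -> {for y, continuous f}.

(** The preimage of an open set is open up to the point [p], and singletons are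
Borel. *)
Lemma measurable_continuous_off_point :
  measurable_fun setT (f : borelRn R n -> R).
Proof.
apply: (measurability _ (RGenOpens.measurableE R)).
move=> _ [_ [a [b ->]] <-]; rewrite setTI.
set V := `]a, b[%classic.
have oV : open (f @^-1` V `&` [set y | y != p]).
  rewrite openE => y [/= Vfy yp].
  apply: filterI; last exact: (open_nbhs_nbhs (conj (open_rV_neq p) yp)).
  apply: (fc _ yp); apply: open_nbhs_nbhs; split; last exact: Vfy.
  exact: interval_open.
rewrite -(setUIDK (f @^-1` V) [set y | y != p]).
apply: measurableU; first exact: borel_open.
have [Vp|nVp] := pselect (V (f p)).
  rewrite (_ : _ `\` _ = [set p]); first exact: borel_set1.
  apply/seteqP; split => [y [_ /negP/negPn/eqP]//|y ->]; split=> //.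
  by rewrite /= eqxx.
rewrite (_ : _ `\` _ = set0) ?measurable0//.
by apply/seteqP; split => // y [+ /negP/negPn/eqP yp]; rewrite /= yp.
Qed.

(** The closed annulus around [c] is compact and avoids [p]. *)
Lemma bounded_continuous_off_point (c : 'rV[R]_n) (r M : R) : `|p - c| < r ->
  exists B, forall y, r <= `|y - c| -> `|y - c| <= M -> `|f y| <= B.
Proof.
move=> pr.
have ncont : continuous (fun y : 'rV[R]_n => `|y - c|).
  by move=> y; exact: (cvg_norm (cvgB cvg_id (cvg_cst c))).
pose A := [set y : 'rV[R]_n | r <= `|y - c|] `&` [set y | `|y - c| <= M].
have cA : compact A.
  apply: bounded_closed_compact.
    exists (M + `|c|); split; first exact: num_real.
    move=> t Mt y [_ /= yM]; apply: le_trans (ltW Mt).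
    by rewrite -{1}(subrK c y) (le_trans (ler_normD _ _))// lerD2r.
  apply: closedI.
    exact: (@preimage_closed _ _ _ [set t : R | r <= t] (fun y _ => ncont y) (@closed_ge _ r)).
  exact: (@preimage_closed _ _ _ [set t : R | t <= M] (fun y _ => ncont y) (@closed_le _ M)).
have fA : {within A, continuous f}.
  apply: continuous_in_subspaceT => y /set_mem[/= ry _]; apply: fc.
  by apply: contraTneq ry => ->; rewrite -ltNge.
have [B [_ fB]] := compact_bounded (continuous_compact fA cA).
exists (B + 1) => y ry yM.
by apply: (fB (B + 1)); [rewrite ltrDl|exists y].
Qed.

End ContinuousOffPoint.

(** * The measure carried by two orbits of homotheties *)

Section Chain.
Context {R : realType} {n : nat}.
Implicit Types (p e f : 'rV[R]_n) (D rho s : R).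

(** The orbit of [p + D *: f] under the homothety of ratio [rho] and centre
[p + D *: e]. *)
Definition chain p e f D rho : ('rV[R]_n)^nat :=
  fun k => p + (D * (1 - rho ^+ k)) *: e + (D * rho ^+ k) *: f.

Lemma chain0 p e f D rho : p - chain p e f D rho 0 = - (D *: f).
Proof.
by rewrite /chain expr0 subrr mulr0 scale0r addr0 mulr1 opprD addNKr.
Qed.

(** The homothety maps [p - s *: e] to [p]: the vector from a point of the orbit
to [p] is [rho] times the vector from the preceding point to [p - s *: e]. *)
Lemma chainS p e f D rho s k : rho * s = D * (1 - rho) ->
  p - chain p e f D rho k.+1 = rho *: (p - s *: e - chain p e f D rho k).
Proof.
move=> hs; apply/rowP => i; rewrite /chain !mxE exprS.
have -> : rho * (p 0 i - s * e 0 i -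
    (p 0 i + D * (1 - rho ^+ k) * e 0 i + D * rho ^+ k * f 0 i)) =
  - (rho * s) * e 0 i - rho * (D * (1 - rho ^+ k) * e 0 i + D * rho ^+ k * f 0 i).
  by ring.
by rewrite hs; ring.
Qed.

End Chain.

Section TransferOfPotential.
Context {R : realType} {n : nat}.
Variables (c e f : 'rV[R]_n) (s D rho q : R) (m : {nonneg R}^nat).
Hypotheses (hs : rho * s = D * (1 - rho)) (mq : forall k, (m k)%:num = q ^+ k).

(** The orbits start at [c + D *: f] and [c + s *: e + D *: f], and drift in
opposite directions along [e]: the first homothety maps [c + s *: e] to [c], the
second maps [c] to [c + s *: e]. *)
Definition chain_measure : {measure set (borelRn R n) -> \bar R} :=
  paired_atoms (m : {nonneg R}^nat)
    (chain c (- e) f D rho : (borelRn R n)^nat)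
    (chain (c + s *: e) e f D rho : (borelRn R n)^nat).

(** Homogeneity turns [chainS] into the shift relations between the two
potentials, and the first atoms contribute equally because they lie at
[D *: f] from [c] and [c + s *: e] respectively. *)
Lemma potential_chain_measure (K : 'rV[R]_n -> R) :
  (forall x, measurable_fun setT ((fun y => K (x - y)) : borelRn R n -> R)) ->
  (forall w, q * K (rho *: w) = K w) ->
  (\int[chain_measure]_y (K (c - (y : 'rV[R]_n)))%:E =
   \int[chain_measure]_y (K (c + s *: e - (y : 'rV[R]_n)))%:E)%E.
Proof.
move=> mK Kq; apply: eq_integral_paired_atoms; [exact: mK|exact: mK| | |].
- by rewrite !chain0.
- move=> k; rewrite !mq (chainS _ _ _ _ _ _ _ hs).
  by rewrite exprSr -mulrA Kq scalerN opprK.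
- move=> k; rewrite !mq (chainS _ _ _ _ _ _ _ hs).
  by rewrite exprSr -mulrA Kq addrK.
Qed.

End TransferOfPotential.

Section ChainGeometry.
Context {R : realType} {n : nat}.
Variables (i j : 'I_n) (ij : i != j) (c : 'rV[R]_n) (s D rho : R).
Hypotheses (s0 : 0 <= s) (D0 : 0 <= D) (rho01 : 0 <= rho <= 1).
Let e : 'rV[R]_n := delta_mx 0 i.
Let f : 'rV[R]_n := delta_mx 0 j.
Let left_chain := chain c (- e) f D rho.
Let right_chain := chain (c + s *: e) e f D rho.

Let rhoX k : 0 <= rho ^+ k <= 1.
Proof. by case/andP: rho01 => r0 r1; rewrite exprn_ge0// exprn_ile1. Qed.

(** One of [t] and [1 - t] is at least one half.  For the orbits [t] is
[rho ^+ k]: what they lose along [f] they gain along [e]. *)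
Lemma norm_ge_half (w : 'rV[R]_n) (t : R) :
  D * (1 - t) <= `|w 0 i| -> D * t <= `|w 0 j| -> D / 2 <= `|w|.
Proof.
move=> wi wj; have := coord_le_norm w i; have := coord_le_norm w j; lra.
Qed.

Lemma left_chain_far k : D / 2 <= `|left_chain k - c|.
Proof.
have /andP[r0 r1] := rhoX k.
apply: (norm_ge_half _ (rho ^+ k)).
  rewrite !mxE !eqxx (negbTE ij)/= [X in `|X|](_ : _ = - (D * (1 - rho ^+ k))).
    by rewrite normrN ler_norm.
  by ring.
rewrite !mxE !eqxx (eq_sym j) (negbTE ij)/= [X in `|X|](_ : _ = D * rho ^+ k).
  exact: ler_norm.
by rewrite oppr0; ring.
Qed.

Lemma right_chain_far k : D / 2 <= `|right_chain k - c|.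
Proof.
have /andP[r0 r1] := rhoX k.
apply: (norm_ge_half _ (rho ^+ k)).
  rewrite !mxE !eqxx (negbTE ij)/= [X in `|X|](_ : _ = s + D * (1 - rho ^+ k)).
    by apply: le_trans (ler_norm _); rewrite lerDr.
  by ring.
rewrite !mxE !eqxx (eq_sym j) (negbTE ij)/= [X in `|X|](_ : _ = D * rho ^+ k).
  exact: ler_norm.
by ring.
Qed.

Lemma chain_bounded p v k :
  `|chain p v f D rho k - c| <= `|p - c| + D * `|v| + D * `|f|.
Proof.
have /andP[r0 r1] := rhoX k.
rewrite /chain (_ : _ - c = (p - c) + (D * (1 - rho ^+ k)) *: v +
    (D * rho ^+ k) *: f); last by rewrite -!addrA; congr (_ + _); rewrite addrA addrC.
apply: le_trans (ler_normD _ _) _; apply: lerD.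
  apply: le_trans (ler_normD _ _) _; apply: lerD => //.
  rewrite normrZ ler_wpM2r// ger0_norm ?mulr_ge0 ?subr_ge0//.
  by rewrite ler_piMr// lerBlDr lerDl.
by rewrite normrZ ler_wpM2r// ger0_norm ?mulr_ge0// ler_piMr.
Qed.

End ChainGeometry.

(** * Failure of the reversal inequality *)

Section AverageDiracPair.
Context {R : realType} {n : nat}.
Variables (x z : 'rV[R]_n) (A : set 'rV[R]_n).
Hypotheses (xz : x <> z) (Ax : A x) (Az : A z).
Local Open Scope ereal_scope.

Let omega : {measure set (borelRn R n) -> \bar R} :=
  dirac_pair (x : borelRn R n) (z : borelRn R n).

Lemma average_dirac_pair (F : 'rV[R]_n -> \bar R) : (forall y, 0 <= F y) ->
  average omega A F = (F x + F z) * 2^-1%:E.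
Proof.
move=> F0; rewrite /average [omega A]dirac_pair_mass//.
rewrite (@integral_dirac_pair _ (borelRn R n) _ _ _ xz (borel_set1 x) (borel_set1 z))//.
by rewrite inver pnatr_eq0.
Qed.

Lemma double_average_dirac_pair (F : 'rV[R]_n -> 'rV[R]_n -> \bar R) :
  (forall y t, 0 <= F y t) ->
  average omega A (fun y => average omega A (F y)) =
  ((F x x + F x z) * 2^-1%:E + (F z x + F z z) * 2^-1%:E) * 2^-1%:E.
Proof.
move=> F0.
rewrite average_dirac_pair => [|y]; rewrite ?average_dirac_pair//.
by rewrite mule_ge0// adde_ge0.
Qed.

End AverageDiracPair.

Section ReversalFails.
Context {R : realType} {n : nat}.
Variables (alpha : R) (J : cube R n).
Local Open Scope ereal_scope.

Lemma cube_length_gt0 : (0 < cube_length J)%R.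
Proof. by rewrite powR_gt0// /cube_volume exprn_gt0// side_gt0. Qed.

Lemma measurable_poisson_kernel :
  measurable_fun setT (fun y : borelRn R n => (cube_length J /
     (cube_length J + enorm ((y : 'rV[R]_n) - Defs.center J))
       `^ (n%:R + 1 - alpha))%:E).
Proof.
apply/measurable_EFinP.
apply: (@measurable_continuous_off_point R n _ (Defs.center J)) => y _.
have den : (0 < cube_length J + enorm (y - Defs.center J))%R.
  by rewrite ltr_pwDl ?cube_length_gt0// sqrtr_ge0.
apply: continuousM; first exact: cst_continuous.
apply: continuousV; first by rewrite gt_eqF// powR_gt0.
apply: (@continuous_comp _ _ _
  (fun y : 'rV[R]_n => cube_length J + enorm (y - Defs.center J))%R
  (fun t : R => t `^ (n%:R + 1 - alpha))%R); last exact: continuous_powR_gt0.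
apply: continuousD; first exact: cst_continuous.
apply: (@continuous_comp _ _ _ (fun y : 'rV[R]_n => y - Defs.center J)%R (@enorm R n)).
  by apply: continuousB; [exact: cvg_id|exact: cst_continuous].
exact: continuous_enorm.
Qed.

(** The potentials have no oscillation on [{x, z}], so the right-hand side is
zero; on the left the energy is half the squared distance from [x] to [z],
measured in units of the side of [J]. *)
Lemma not_strong_energy_reversal_dirac_pair N (K : 'I_N -> 'rV[R]_n -> R)
    (mu : {measure set (borelRn R n) -> \bar R}) (C0 : R) (x z : 'rV[R]_n) :
  x <> z -> cube_set J x -> cube_set J z -> 0 < poisson alpha J mu ->
  conv_op K mu x = conv_op K mu z ->
  ~ strong_energy_reversal alpha J K mu C0
      (dirac_pair (x : borelRn R n) (z : borelRn R n)).
Proof.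
move=> xz Jx Jz P0 Kxz; rewrite /strong_energy_reversal.
rewrite /energy_sq !(double_average_dirac_pair _ _ _ xz Jx Jz); last 2 first.
- by move=> y t; rewrite lee_fin sqr_ge0.
- by move=> y t; rewrite lee_fin sqr_ge0.
rewrite Kxz !subrr !scaler0 !enorm0 expr0n/= !(adde0, mul0e) mule0.
apply/negP; rewrite -ltNge.
have half_gt0 : 0 < (2^-1)%:E :> \bar R by rewrite lte_fin invr_gt0.
have dist_gt0 (y t : 'rV[R]_n) : y <> t ->
    0 < (enorm ((cube_length J)^-1 *: (y - t)) ^+ 2)%:E.
  move=> /eqP yt; rewrite lte_fin exprn_gt0// enorm_gt0 scaler_eq0.
  by rewrite invr_eq0 (gt_eqF cube_length_gt0) subr_eq0.
apply: mule_gt0; last by rewrite mule_gt0.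
rewrite mule_gt0// adde_gt0// mule_gt0//.
- by rewrite add0e dist_gt0.
- by rewrite dist_gt0// => /esym.
Qed.

End ReversalFails.

Theorem corollary1 (R : realType) (n : nat) (alpha : R) (J : cube R n)
    (n_ge2 : (2 <= n)%N) (alpha_ge0 : 0 <= alpha) (alpha_ltn : alpha < n%:R) :
  exists gamma0 : R, forall gamma : R, 2 < gamma -> gamma0 <= gamma ->
  exists mu : {measure set (borelRn R n) -> \bar R},
    [/\ locally_finite mu,
        measure_support mu `<=` ~` dilate gamma J &
        forall C0 : R, 0 < C0 ->
        forall (N : nat) (Omega : 'I_N -> 'rV[R]_n -> R), (0 < N)%N ->
        (forall l, smooth_on_sphere (Omega l)) ->
        let K := fun l => homogeneous_kernel alpha (Omega l) in
        ((forall l, vanishing_on_great_circles (Omega l)) ->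
           strong_energy_reversal_fails alpha J K mu C0) /\
        ((forall l, odd_kernel (K l)) ->
           strong_energy_reversal_fails alpha J K mu C0)].
Proof.
exists 2 => gamma gamma2 _.
have L0 := side_gt0 J; set L := side J in L0.
pose c := Defs.center J.
pose i0 : 'I_n := Ordinal (ltnW n_ge2).
pose i1 : 'I_n := Ordinal n_ge2.
have i01 : i0 != i1 by [].
pose e : 'rV[R]_n := delta_mx 0 i0.
pose f : 'rV[R]_n := delta_mx 0 i1.
pose s := L / 2.
(* The relation [rho * s = D * (1 - rho)], which determines [rho] from [s] and
   [D], says that one homothety maps [z] to [c] and the other [c] to [z].  The
   orbits stay at sup-distance at least [D / 2 = gamma * L] from [c], twice the
   half-side of [gamma J]. *)
pose D := 2 * gamma * L.
pose rho := 4 * gamma / (4 * gamma + 1).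
have den0 : 0 < 4 * gamma + 1 by lra.
have rho0 : 0 < rho by rewrite divr_gt0//; lra.
have rho1 : rho < 1 by rewrite ltr_pdivrMr//; lra.
have rho01 : 0 <= rho <= 1 by rewrite !ltW.
have s0 : 0 <= s by rewrite divr_ge0// ltW.
have D0 : 0 <= D by rewrite !mulr_ge0//; lra.
have hs : rho * s = D * (1 - rho).
  by rewrite /rho /s /D; field; rewrite gt_eqF.
pose q := rho `^ (n%:R - alpha).
have q0 : 0 < q by rewrite powR_gt0.
have q1 : q < 1.
  rewrite [ltRHS](_ : 1 = 1 `^ (n%:R - alpha)); last by rewrite powR1.
  by rewrite gt0_ltr_powR ?subr_gt0 ?nnegrE// ltW.
pose m : {nonneg R}^nat := fun k => NngNum (exprn_ge0 k (ltW q0)).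
have mq k : (m k)%:num = q ^+ k by [].
pose z := c + s *: e.
pose mu := chain_measure c e f s D rho m.
have Jc : cube_set J c.
  by move=> i; rewrite subrr normr0 divr_ge0// ltW.
have Jz : cube_set J z.
  move=> i; rewrite !mxE addrAC subrr add0r.
  by case: (_ && _); rewrite ?mulr1 ?mulr0 ?normr0// ger0_norm.
have cz : c <> z.
  move=> /rowP/(_ i0); rewrite !mxE !eqxx mulr1.
  by have : 0 < s by [rewrite divr_gt0]; lra.
have box_norm (t : R) x : 0 <= t -> box c t x -> `|x - c| <= t / 2.
  move=> t0 bx; apply: norm_le_coord; first by rewrite divr_ge0.
  by move=> i; rewrite !mxE; exact: bx.
have gL : 0 < gamma * L by rewrite mulr_gt0//; lra.
have far_a k : gamma * L <= `|chain c (- e) f D rho k - c|.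
  apply: le_trans (left_chain_far i0 i1 i01 c D rho rho01 k).
  by rewrite /D; lra.
have far_b k : gamma * L <= `|chain z e f D rho k - c|.
  apply: le_trans (right_chain_far i0 i1 i01 c s D rho s0 rho01 k).
  by rewrite /D; lra.
have mu_fin : (mu setT < +oo)%E.
  by apply: (paired_atoms_geometric_finite _ _ _ q); rewrite ?q0.
exists mu; split.
- by move=> x; exists setT; split => //; split => //; exact: openT.
- move=> x xsupp xdil.
  have : open_nbhs x (ball c (gamma * L)).
    split; first exact: ball_open.
    rewrite -ball_normE /ball_ /= distrC; apply: le_lt_trans (box_norm _ _ _ xdil) _.
      by rewrite ltW.
    by rewrite -/L; lra.
  move=> /xsupp; rewrite /mu /chain_measure paired_atoms_eq0 ?ltxx// => k.
    by rewrite -ball_normE /ball_ /= distrC ltNge far_a.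
  by rewrite -ball_normE /ball_ /= distrC ltNge far_b.
move=> C0 _ N Omega _ smO K.
have Kc l x y : y != x -> {for y, continuous (fun t : 'rV[R]_n => K l (x - t))}.
  exact: continuous_translated_kernel.
suff fails : strong_energy_reversal_fails alpha J K mu C0 by [].
split.
  move=> l x Jx.
  have xc : `|x - c| < gamma * L.
    by apply: le_lt_trans (box_norm _ _ (ltW L0) Jx) _; rewrite ltr_pdivrMr//; nra.
  have [B fB] := bounded_continuous_off_point _ x (Kc l x) c _
    (Num.max (`|c - c| + D * `|- e| + D * `|f|) (`|z - c| + D * `|e| + D * `|f|)) xc.
  apply: (integrable_paired_atoms _ _ _ _ B) => //.
  - exact: measurable_continuous_off_point (Kc l x).
  - move=> k; apply: fB; first exact: far_a.
    by rewrite le_max chain_bounded.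
  - move=> k; apply: fB; first exact: far_b.
    by rewrite le_max chain_bounded ?orbT.
exists (dirac_pair (c : borelRn R n) (z : borelRn R n)); split.
- move=> x; exists setT; split; first by split => //; exact: openT.
  by rewrite [ltLHS]dirac_pair_mass// ltry.
- by rewrite [ltRHS]dirac_pair_mass// lte_fin.
apply: (not_strong_energy_reversal_dirac_pair _ _ _ _ _ _ _ _ cz Jc Jz).
  apply: paired_atoms_integral_gt0 => //; first exact: measurable_poisson_kernel.
  move=> y; rewrite lte_fin divr_gt0 ?cube_length_gt0// powR_gt0//.
  by rewrite ltr_pwDl ?cube_length_gt0// sqrtr_ge0.
apply/rowP => l; rewrite [LHS]mxE [RHS]mxE.
apply: (f_equal fine).
apply: (potential_chain_measure c e f s D rho q m hs mq (K l)).
  by move=> x; exact: measurable_continuous_off_point (Kc l x).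
by move=> w; exact: homogeneous_kernelZ.
Qed.
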